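(* Consider the problem of maximizing $x\mapsto E\,U(W(x))$ over all $x\in\mathbb{R}^d$. A portfolio $x^\star\in\mathbb{R}^d$ is a solution of this problem if and only if $$x^\star=\frac{1}{aW_0}\Big[\Sigma^{-1}\gamma-q_{min}\,\Sigma^{-1}(\mu-\mathbf{1}r_f)\Big]$$ for some $$q_{min}\in\arg\min_{\theta\in\Theta}Q(\theta),$$ where $\Theta=[-\hat\theta,\hat\theta]$ if $\hat\theta=\sqrt{(\mathcal{A}-2\hat s)/\mathcal{C}}<\infty$, and $\Theta=(-\infty,+\infty)$ if $\hat\theta=+\infty$.
   Context: Setting. $d\ge 1$; $r_f\in\mathbb{R}$ is the risk-free rate; $\mathbf{1}\in\mathbb{R}^d$ is the all-ones vector. The risky return vector $X$ in $\mathbb{R}^d$ is a normal mean-variance mixture: $X\overset{d}{=}\mu+\gamma Z+\sqrt{Z}\,AN$, where $\mu,\gamma\in\mathbb{R}^d$, $A\in\mathbb{R}^{d\times d}$ is symmetric positive definite, $N$ is a standard $d$-dimensional Gaussian vector, and $Z$ is a non-negative random variable independent of $N$. Put $\Sigma=AA^T$ (positive definite). Standing assumptions: $\mu-\mathbf{1}r_f\neq 0$ and $P(Z\neq 0)>0$. For initial capital $W_0>0$ and $x\in\mathbb{R}^d$, the wealth is $W(x)=W_0(1+r_f)+W_0\,x^T(X-\mathbf{1}r_f)$. The utility is $U(w)=-e^{-aw}$ with $a>0$; $E\,U(W(x))\in[-\infty,0)$. $\mathcal{L}_Z(s)=E e^{-sZ}\in(0,+\infty]$ for $s\in\mathbb{R}$.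 The critical value $\hat s\in[-\infty,0]$ of $Z$: $\hat s=-\infty$ if $\mathcal{L}_Z(s)<\infty$ for all $s\in\mathbb{R}$; otherwise $\hat s$ is the real number with $\mathcal{L}_Z(s)<\infty$ for all $s>\hat s$ and $\mathcal{L}_Z(s)=+\infty$ for all $s<\hat s$. Notation: $\mathcal{A}=\gamma^T\Sigma^{-1}\gamma$, $\mathcal{C}=(\mu-\mathbf{1}r_f)^T\Sigma^{-1}(\mu-\mathbf{1}r_f)>0$, $Q(\theta)=e^{\mathcal{C}\theta}\mathcal{L}_Z\big(\tfrac12\mathcal{A}-\tfrac{\theta^2}{2}\mathcal{C}\big)\in(0,+\infty]$, and $\hat\theta=\sqrt{(\mathcal{A}-2\hat s)/\mathcal{C}}$ (equal to $+\infty$ if $\hat s=-\infty$). *)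

(* Defs.v *)
From HB Require Import structures.
From mathcomp Require Import all_boot all_order all_algebra.
From mathcomp Require Import all_classical all_reals all_analysis.

Set Implicit Arguments.
Unset Strict Implicit.
Unset Printing Implicit Defensive.

Import Order.TTheory GRing.Theory Num.Theory.
Import numFieldNormedType.Exports.

Local Open Scope classical_set_scope.
Local Open Scope ring_scope.

(* Random vectors take their values in [d.-tuple R], which carries the product
   (Borel) sigma-algebra; the vector algebra is done in ['cV[R]_d]. *)

Definition cv_of_tuple (R : realType) (d : nat) (t : d.-tuple R) : 'cV[R]_d :=
  \col_i tnth t i.

Definition tuple_of_cv (R : realType) (d : nat) (v : 'cV[R]_d) : d.-tuple R :=
  [tuple v i 0 | i < d].

Definition dotv (R : realType) (d : nat) (u v : 'cV[R]_d) : R :=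
  (u^T *m v) 0 0.

Definition sym_posdef (R : realType) (d : nat) (A : 'M[R]_d) : Prop :=
  A^T = A /\ forall v : 'cV[R]_d, v != 0 -> 0 < dotv v (A *m v).

Definition eq_distribution (R : realType) (d1 d2 d3 : measure_display)
    (T1 : measurableType d1) (T2 : measurableType d2) (E : measurableType d3)
    (P1 : probability T1 R) (P2 : probability T2 R)
    (Y1 : T1 -> E) (Y2 : T2 -> E) : Prop :=
  forall B : set E, measurable B -> P1 (Y1 @^-1` B) = P2 (Y2 @^-1` B).

Definition independent (R : realType) (d1 d2 d3 : measure_display)
    (T : measurableType d1) (E : measurableType d2) (F : measurableType d3)
    (P : probability T R) (Y : T -> E) (Z : T -> F) : Prop :=
  forall (B : set E) (C : set F), measurable B -> measurable C ->
    P (Y @^-1` B `&` Z @^-1` C) = (P (Y @^-1` B) * P (Z @^-1` C))%E.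

Definition mutually_independent (R : realType) (dT dE : measure_display)
    (T : measurableType dT) (E : measurableType dE) (P : probability T R)
    (d : nat) (Y : 'I_d -> T -> E) : Prop :=
  forall (J : {set 'I_d}) (B : 'I_d -> set E),
    (forall i, measurable (B i)) ->
    P (\bigcap_(i in [set` J]) Y i @^-1` B i) =
    (\prod_(i in J) P (Y i @^-1` B i))%E.

Definition standard_gaussian (R : realType) (dT : measure_display)
    (T : measurableType dT) (P : probability T R) (d : nat)
    (N : T -> d.-tuple R) : Prop :=
  let coord := fun (i : 'I_d) (w : T) => tnth (N w) i in
  (forall i (B : set R), measurable B ->
     P (coord i @^-1` B) = normal_prob 0 1 B) /\
  mutually_independent P coord.

Definition normal_mixture (R : realType) (d : nat) (mu gamma : 'cV[R]_d)
    (A : 'M[R]_d) (z : R) (g : 'cV[R]_d) : 'cV[R]_d :=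
  mu + z *: gamma + Num.sqrt z *: (A *m g).

Definition wealth (R : realType) (d : nat) (W0 rf : R) (x X : 'cV[R]_d) : R :=
  W0 * (1 + rf) + W0 * dotv x (X - const_mx rf).

Definition exp_utility (R : realType) (a w : R) : R := - expR (- a * w).

Definition expected_utility (R : realType) (dT : measure_display)
    (T : measurableType dT) (P : probability T R) (d : nat)
    (X : T -> d.-tuple R) (W0 rf a : R) (x : 'cV[R]_d) : \bar R :=
  'E_P[fun w => exp_utility a (wealth W0 rf x (cv_of_tuple (X w)))].

Definition laplace (R : realType) (dT : measure_display)
    (T : measurableType dT) (P : probability T R) (Z : T -> R) (s : R) : \bar R :=
  'E_P[fun w => expR (- s * Z w)].

(* [shat = +oo] is excluded: the Laplace transform of a non-negative random
   variable is finite on [0, +oo[. *)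
Definition critical_value (R : realType) (L : R -> \bar R) (shat : \bar R)
    : Prop :=
  match shat with
  | -oo%E => forall s : R, (L s < +oo)%E
  | (r%:E)%E => (forall s : R, r < s -> (L s < +oo)%E) /\
                (forall s : R, s < r -> L s = +oo%E)
  | +oo%E => False
  end.

Definition calA (R : realType) (d : nat) (Sigma : 'M[R]_d)
    (gamma : 'cV[R]_d) : R :=
  dotv gamma (invmx Sigma *m gamma).

Definition calC (R : realType) (d : nat) (Sigma : 'M[R]_d) (mu : 'cV[R]_d)
    (rf : R) : R :=
  dotv (mu - const_mx rf) (invmx Sigma *m (mu - const_mx rf)).

Definition Qfun (R : realType) (L : R -> \bar R) (cA cC theta : R) : \bar R :=
  ((expR (cC * theta))%:E * L (2^-1 * cA - theta ^+ 2 / 2 * cC)%R)%E.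

Definition theta_hat (R : realType) (cA cC : R) (shat : \bar R) : \bar R :=
  sqrte ((cA%:E - 2%:E * shat) * (cC^-1)%:E)%E.

Definition Theta (R : realType) (that : \bar R) : set R :=
  match that with
  | (r%:E)%E => `[- r, r]
  | _ => [set: R]
  end.

Definition argmax_set (R : realType) (E : Type) (D : set E)
    (f : E -> \bar R) : set E :=
  [set x | D x /\ forall y, D y -> (f y <= f x)%E].

Definition argmin_set (R : realType) (E : Type) (D : set E)
    (f : E -> \bar R) : set E :=
  [set x | D x /\ forall y, D y -> (f x <= f y)%E].

(* Main.v *)
Require Import Defs.
From HB Require Import structures.
From mathcomp Require Import all_boot all_order all_algebra.
From mathcomp Require Import all_classical all_reals all_analysis.
From mathcomp Require Import measurable_realfun ring lra.

Import Order.TTheory GRing.Theory Num.Theory.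
Import numFieldNormedType.Exports.
Import HBNNSimple.

Local Open Scope classical_set_scope.
Local Open Scope ring_scope.

(* Write v = a W0 x, m = mu - rf 1 and S = A A^T. Conditionally on Z the
   exponent is Gaussian, so up to a positive factor the expected utility of x is
   - e^(- v.m) L(v.gamma - v.(S v) / 2), with L the Laplace transform of Z.
   Substituting v = S^-1 gamma - w turns the argument of L into
   cA / 2 - w.(S w) / 2, and decomposing w = q S^-1 m + u with u orthogonal to m
   gives w.(S w) = q^2 cC + u.(S u) and w.m = q cC. As L is strictly decreasing
   where it is finite (Z does not vanish almost surely), the optimal u is 0, and
   the remaining quantity to minimize is Q(q), which is infinite off Theta. *)

(** * Exponential moments of standard Gaussian vectors *)

(** The hypothesis is the case of indicators; linearity gives simple functions and monotone
    convergence the rest. It serves both for a density [g] (with [Y] the identity) and for a factor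
    [g] independent of [Y]. *)
Lemma integral_mul_comp (R : realType) (d1 d2 : measure_display)
    (T : measurableType d1) (E : measurableType d2)
    (P : {measure set T -> \bar R}) (Q : {measure set E -> \bar R})
    (g : T -> R) (Y : T -> E) (c : R) (f : E -> R) :
  measurable_fun [set: T] g -> (forall w, 0 <= g w) ->
  measurable_fun [set: T] Y -> 0 <= c ->
  (forall B : set E, measurable B ->
    (\int[P]_w (g w * \1_B (Y w))%:E = c%:E * Q B)%E) ->
  measurable_fun [set: E] f -> (forall y, 0 <= f y) ->
  (\int[P]_w (g w * f (Y w))%:E = c%:E * \int[Q]_y (f y)%:E)%E.
Proof.
move=> mg g0 mY c0 gYQ mf f0.
have mEf : measurable_fun [set: E] (EFin \o f) by exact/measurable_EFinP.
have Ef0 y : [set: E] y -> (0 <= (EFin \o f) y)%E by rewrite lee_fin.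
pose h := nnsfun_approx measurableT mEf.
have nd_h y m n : (m <= n)%N -> h m y <= h n y.
  by move=> mn; exact/lefP/nd_nnsfun_approx.
have cvg_h y : (h n y)%:E @[n --> \oo] --> (f y)%:E.
  exact: (cvg_nnsfun_approx measurableT mEf Ef0).
have mh n : measurable_fun [set: E] (h n) by exact: measurable_funP.
have hE n : (\int[P]_w (g w * h n (Y w))%:E = c%:E * \int[Q]_y (h n y)%:E)%E.
  pose s : seq R := finmap.enum_fset (fset_set (range (h n))).
  pose H r := h n @^-1` [set r].
  have mH r : measurable (H r) by exact: measurable_sfunP.
  have hs y : h n y = \sum_(r <- s) r * \1_(H r) y.
    by rewrite [LHS]fimfunE fsbig_finite.
  have H0 r y : 0 <= r * \1_(H r) y.
    by rewrite -lee_fin EFinM; exact: nnfun_muleindic_ge0.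
  have mHY r : measurable_fun [set: T] (fun w => (\1_(H r) (Y w) : R)).
    exact: (measurableT_comp (f := (\1_(H r) : E -> R))).
  transitivity (\int[P]_w (\sum_(r <- s) (g w * (r * \1_(H r) (Y w)))%R%:E))%E.
    by apply: eq_integral => w _; rewrite hs mulr_sumr sumEFin.
  transitivity (c%:E * \int[Q]_y (\sum_(r <- s) (r * \1_(H r) y)%:E))%E; last first.
    by congr (_ * _)%E; apply: eq_integral => y _; rewrite hs sumEFin.
  rewrite ge0_integral_sum//; last 2 first.
  - move=> r; apply/measurable_EFinP/measurable_funM => //.
    by apply: measurable_funM.
  - by move=> r w _; rewrite lee_fin mulr_ge0.
  rewrite ge0_integral_sum//; last 2 first.
  - move=> r; apply/measurable_EFinP/measurable_funM => //.
  - by move=> r w _; rewrite lee_fin.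
  rewrite ge0_sume_distrr; last first.
    by move=> r _; apply: integral_ge0 => y _; rewrite lee_fin.
  apply: eq_bigr => r _.
  (* The sum gives no membership of [r] in the range, so negative [r] are treated apart: their level
     set is empty. The constant can then be pulled out for [0 <= r]. *)
  have [r0|r0] := ltP r 0.
    have -> : H r = set0 by exact: preimage_nnfun0.
    under eq_integral do rewrite indic0 !mulr0.
    under [in RHS]eq_integral do rewrite indic0 !mulr0.
    by rewrite !integral0 mule0.
  transitivity (r%:E * \int[P]_w (g w * \1_(H r) (Y w))%:E)%E.
    rewrite -ge0_integralZl//; last 2 first.
    - by apply/measurable_EFinP; apply: measurable_funM.
    - by move=> w _; rewrite lee_fin mulr_ge0.
    by apply: eq_integral => w _; rewrite -EFinM mulrCA.
  rewrite gYQ// integralZl_indic_nnsfun// integral_indic// setIT.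
  by rewrite muleCA.
have cvgl : (\int[P]_w (g w * h n (Y w))%:E)%E @[n --> \oo] -->
    (\int[P]_w (g w * f (Y w))%:E)%E.
  rewrite [X in _ --> X](_ : _ =
      \int[P]_w limn (fun n => (g w * h n (Y w))%:E))%E; last first.
    apply: eq_integral => w _; apply/esym/cvg_lim => //.
    under eq_fun do rewrite EFinM.
    by rewrite EFinM; apply: cvgeZl.
  apply: cvg_monotone_convergence => //.
  - move=> n; apply/measurable_EFinP/measurable_funM => //.
    exact: measurableT_comp.
  - by move=> n w _; rewrite lee_fin mulr_ge0.
  - by move=> w _ m n mn; rewrite lee_fin ler_wpM2l// nd_h.
have cvgr : (c%:E * \int[Q]_y (h n y)%:E)%E @[n --> \oo] -->
    (c%:E * \int[Q]_y (f y)%:E)%E.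
  apply: cvgeZl => //.
  rewrite [X in _ --> X](_ : _ = \int[Q]_y limn (fun n => (h n y)%:E))%E.
    apply: cvg_monotone_convergence => //.
    - by move=> n; apply/measurable_EFinP.
    - by move=> n w _; rewrite lee_fin.
    - by move=> w _ m n mn; rewrite lee_fin nd_h.
  by apply: eq_integral => y _; apply/esym/cvg_lim.
by rewrite -(cvg_lim _ cvgl)// -(cvg_lim _ cvgr)//; under eq_fun do rewrite hE.
Qed.

(** Completing the square turns [expR (t * x)] times the standard density into [expR (t ^+ 2 / 2)]
    times the density of mean [t], whose mass is 1. *)
Lemma integral_normal_prob_expR (R : realType) (t : R) :
  (\int[normal_prob 0 1]_x (expR (t * x))%:E = (expR (t ^+ 2 / 2))%:E)%E.
Proof.
have := @integral_mul_comp R _ _ _ _ lebesgue_measure (normal_prob 0 1)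
  (normal_pdf 0 1) id 1 (fun x => expR (t * x)) (measurable_normal_pdf 0 1)
  (normal_pdf_ge0 0 1) (@measurable_id _ _ _) ler01.
rewrite mul1e => <- //; last 2 first.
- move=> B mB; rewrite mul1e/= /normal_prob [in RHS]integral_mkcond.
  apply: eq_integral => x _; rewrite /patch /indic.
  by case: ifP => _; rewrite ?mulr1 ?mulr0.
- by apply: measurableT_comp => //; exact: measurable_funM.
under eq_integral => x _.
  rewrite (_ : _ * _ = expR (t ^+ 2 / 2) * normal_pdf t 1 x); last first.
    rewrite !normal_pdfE ?oner_neq0// -mulrA [RHS]mulrCA; congr (_ * _).
    rewrite /normal_fun -!expRD; congr expR.
    by rewrite expr1n; field.
  rewrite EFinM.
  over.
rewrite ge0_integralZl//; last 2 first.
- by apply/measurable_EFinP; exact: (measurable_normal_pdf t 1).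
- by move=> x _; rewrite lee_fin normal_pdf_ge0.
by rewrite integral_normal_pdf mule1.
Qed.

(* One coordinate at a time, [integral_mul_comp] replaces the indicators of the
   definition of independence by arbitrary nonnegative functions. *)
Lemma integral_prod_independent (R : realType) (dT dE : measure_display)
    (T : measurableType dT) (E : measurableType dE) (P : probability T R)
    (Q : probability E R) (d : nat) (Y : 'I_d -> T -> E) (h : 'I_d -> E -> R) :
  (forall i, measurable_fun [set: T] (Y i)) ->
  (forall i B, measurable B -> P (Y i @^-1` B) = Q B) ->
  mutually_independent P Y ->
  (forall i, measurable_fun [set: E] (h i)) -> (forall i y, 0 <= h i y) ->
  (forall i, \int[Q]_y (h i y)%:E < +oo)%E ->
  (\int[P]_w (\prod_i h i (Y i w))%:E =
   (\prod_i fine (\int[Q]_y (h i y)%:E)%E)%:E)%E.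
Proof.
move=> mY YQ Yind.
(* Induction on a list [s] of coordinates carrying arbitrary functions, all the others carrying
   indicators; [enum 'I_d] leaves no restriction. *)
suff H (s : seq 'I_d) (k : 'I_d -> E -> R) :
    (forall i, measurable_fun [set: E] (k i)) -> (forall i y, 0 <= k i y) ->
    (forall i, \int[Q]_y (k i y)%:E < +oo)%E ->
    (forall i, i \notin s -> exists2 B, measurable B & k i = \1_B) ->
    (\int[P]_w (\prod_i k i (Y i w))%:E =
     (\prod_i fine (\int[Q]_y (k i y)%:E)%E)%:E)%E.
  by move=> mh h0 hoo; apply: (H (enum 'I_d)) => // i; rewrite mem_enum.
elim: s k => [|i s IHs] k mk k0 koo ks.
  have [B mB kB] : exists2 B : 'I_d -> set E,
      forall i, measurable (B i) & forall i, k i = \1_(B i).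
    have [B HB] := choice (fun i => let: ex_intro2 B mB kB := ks i isT in
      ex_intro (fun B => measurable B /\ k i = \1_B) B (conj mB kB)).
    by exists B => i; case: (HB i).
  (* Base case: a product of indicators is the indicator of the intersection, so independence
     applies with the full index set. *)
  transitivity (P (\bigcap_(i in [set` [set: 'I_d]%SET]) Y i @^-1` B i)).
    rewrite -[X in P X]setIT -integral_indic//; last first.
      apply: fin_bigcap_measurable => // i _.
      by rewrite -[_ @^-1` _]setTI; exact: mY.
    apply: eq_integral => w _; congr EFin.
    under eq_bigr do rewrite kB indicE.
    rewrite indicE.
    have [Yw|/existsNP[i /= Ywi]] := pselect (forall i, B i (Y i w)).
      rewrite [w \in _]mem_set; last by move=> i _; exact: Yw.
      by rewrite big1// => i _; rewrite mem_set.
    rewrite [w \in _]memNset; last first.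
      by move=> /(_ i) Bi; apply: Ywi; apply: Bi; rewrite /= inE.
    by rewrite (bigD1 i)//= memNset// mul0r.
  rewrite (Yind [set: 'I_d]%SET B mB) -prodEFin.
  apply: eq_big => [i|i _]; first by rewrite inE.
  by rewrite YQ// fineK kB integral_indic// ?setIT// fin_num_measure.
have [si|nsi] := boolP (i \in s).
  apply: IHs => // j js; apply: ks; rewrite inE negb_or js andbT.
  by apply: contraNneq js => ->.
rewrite (bigD1 i)//= EFinM fineK; last first.
  by rewrite ge0_fin_numE// integral_ge0// => y _; rewrite lee_fin.
rewrite muleC.
under eq_integral do rewrite (bigD1 i)//= mulrC.
(* The weight is the product of the other factors, and [c] the product of their integrals. *)
apply: (@integral_mul_comp R _ _ _ _ P Q _ (Y i)) => //.
- under eq_fun do rewrite -big_filter.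
  by apply: measurable_prod => j _; exact: measurableT_comp.
- by move=> w; apply: prodr_ge0.
- apply: prodr_ge0 => j _; rewrite fine_ge0// integral_ge0// => y _.
  by rewrite lee_fin.
move=> B mB.
(* With an indicator put back at coordinate [i], the identity required by [integral_mul_comp] is the
   induction hypothesis. *)
pose k' j := if j == i then \1_B else k j.
have k'i : k' i = \1_B by rewrite /k' eqxx.
have k'ne j : j != i -> k' j = k j by rewrite /k' => /negbTE ->.
have Ek'i : (\int[Q]_y (k' i y)%:E = Q B)%E.
  by rewrite k'i integral_indic// setIT.
transitivity (\int[P]_w (\prod_j k' j (Y j w))%:E)%E.
  apply: eq_integral => w _; rewrite [in RHS](bigD1 i)//= k'i mulrC.
  by congr (_ * _)%:E; apply: eq_bigr => j ji; rewrite k'ne.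
rewrite IHs; last 4 first.
- move=> j; have [->|ji] := eqVneq j i; last by rewrite k'ne.
  by rewrite k'i; exact: measurable_indic.
- move=> j y; have [->|ji] := eqVneq j i; last by rewrite k'ne.
  by rewrite k'i indicE.
- move=> j; have [->|ji] := eqVneq j i; last by rewrite k'ne.
  by rewrite Ek'i (le_lt_trans (probability_le1 _ mB))// ltry.
- move=> j js; have [->|ji] := eqVneq j i; first by exists B.
  by rewrite k'ne//; apply: ks; rewrite inE negb_or ji.
rewrite (bigD1 i)//= Ek'i mulrC EFinM fineK ?fin_num_measure//.
by congr (_%:E * _)%E; apply: eq_bigr => j ji; rewrite k'ne.
Qed.

Lemma dotvE (R : realType) (d : nat) (u v : 'cV[R]_d) :
  dotv u v = \sum_i u i 0 * v i 0.
Proof. by rewrite /dotv mxE; apply: eq_bigr => i _; rewrite mxE. Qed.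

Lemma measurable_dotv_tuple (R : realType) (dT : measure_display)
    (T : measurableType dT) (d : nat) (N : T -> d.-tuple R) (b : 'cV[R]_d) :
  measurable_fun [set: T] N ->
  measurable_fun [set: T] (fun w => dotv b (cv_of_tuple (N w))).
Proof.
move=> mN; under eq_fun do rewrite dotvE.
apply: measurable_sum => i; apply: measurable_funM => //.
under eq_fun do rewrite mxE.
by apply: (measurableT_comp (f := fun t : d.-tuple R => tnth t i)) => //;
  exact: measurable_tnth.
Qed.

(** The exponential of the inner product factors over the independent coordinates, each contributing
    a one-dimensional moment. *)
Lemma integral_standard_gaussian_expR (R : realType) (dT : measure_display)
    (T : measurableType dT) (P : probability T R) (d : nat)
    (N : T -> d.-tuple R) (b : 'cV[R]_d) :
  measurable_fun [set: T] N -> standard_gaussian P N ->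
  (\int[P]_w (expR (dotv b (cv_of_tuple (N w))))%:E =
   (expR (dotv b b / 2))%:E)%E.
Proof.
move=> mN [Nnorm Nind].
have intE i : (\int[normal_prob 0 1]_y (expR (b i 0 * y))%:E =
    (expR ((b i 0) ^+ 2 / 2))%:E)%E by exact: integral_normal_prob_expR.
transitivity (\int[P]_w (\prod_i expR (b i 0 * tnth (N w) i))%:E)%E.
  apply: eq_integral => w _; rewrite -expR_sum dotvE.
  by congr (expR _)%:E; apply: eq_bigr => i _; rewrite mxE.
rewrite (@integral_prod_independent R _ _ T _ P (normal_prob 0 1) d
  (fun i w => tnth (N w) i) (fun i y => expR (b i 0 * y))) //.
- under eq_bigr do rewrite intE/=.
  by rewrite -expR_sum dotvE mulr_suml; congr (expR _)%:E.
- move=> i.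
  by apply: (measurableT_comp (f := fun t : d.-tuple R => tnth t i)) => //;
    exact: measurable_tnth.
- by move=> i; apply: measurableT_comp => //; exact: measurable_funM.
- by move=> i; rewrite intE ltry.
Qed.

(** * Fubini for independent variables *)

(** By uniqueness of the product measure, independence makes the joint law the product of the
    marginal laws; Tonelli then applies. *)
Lemma integral_independent (R : realType) (dT d1 d2 : measure_display)
    (T : measurableType dT) (E : measurableType d1) (F : measurableType d2)
    (P : probability T R) (Y : {RV P >-> E}) (Z : {RV P >-> F})
    (f : E * F -> \bar R) :
  independent P Y Z ->
  measurable_fun [set: E * F] f -> (forall p, 0 <= f p)%E ->
  (\int[P]_w f (Y w, Z w) = \int[P]_w \int[P]_v f (Y w, Z v))%E.
Proof.
move=> YZ mf f0.
have mYZ : measurable_fun [set: T] (fun w => (Y w, Z w)).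
  by apply: measurable_fun_pair.
pose V : {RV P >-> (E * F)%type} :=
  HB.pack (fun w => (Y w, Z w)) (isMeasurableFun.Build _ _ _ _ _ mYZ).
transitivity (\int[distribution P V]_p f p)%E.
  by rewrite ge0_integral_distribution.
transitivity (\int[distribution P Y \x distribution P Z]_p f p)%E.
  apply: eq_measure_integral => A mA _; apply/esym.
  apply: product_measure_unique => // B C; exact: YZ.
rewrite fubini_tonelli1// ge0_integral_distribution//; last 2 first.
- exact: measurable_fun_fubini_tonelli_F.
- by move=> y; apply: integral_ge0.
apply: eq_integral => w _ /=; rewrite /fubini_F ge0_integral_distribution//.
exact: measurableT_comp.
Qed.

(** * Bilinearity of the inner product *)

Lemma dotvC (R : realType) (d : nat) (u v : 'cV[R]_d) : dotv u v = dotv v u.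
Proof. by rewrite !dotvE; apply: eq_bigr => i _; rewrite mulrC. Qed.

Lemma dotvDr (R : realType) (d : nat) (u v w : 'cV[R]_d) :
  dotv u (v + w) = dotv u v + dotv u w.
Proof. by rewrite /dotv mulmxDr mxE. Qed.

Lemma dotvZr (R : realType) (d : nat) (c : R) (u v : 'cV[R]_d) :
  dotv u (c *: v) = c * dotv u v.
Proof. by rewrite /dotv -scalemxAr mxE. Qed.

Lemma dotvNr (R : realType) (d : nat) (u v : 'cV[R]_d) :
  dotv u (- v) = - dotv u v.
Proof. by rewrite -scaleN1r dotvZr mulN1r. Qed.

Lemma dotvBr (R : realType) (d : nat) (u v w : 'cV[R]_d) :
  dotv u (v - w) = dotv u v - dotv u w.
Proof. by rewrite dotvDr dotvNr. Qed.

Lemma dotvZl (R : realType) (d : nat) (c : R) (u v : 'cV[R]_d) :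
  dotv (c *: u) v = c * dotv u v.
Proof. by rewrite dotvC dotvZr dotvC. Qed.

Lemma dotvBl (R : realType) (d : nat) (u v w : 'cV[R]_d) :
  dotv (u - v) w = dotv u w - dotv v w.
Proof. by rewrite dotvC dotvBr !(dotvC _ _ _ w). Qed.

Lemma dotv_mulmx (R : realType) (d : nat) (M : 'M[R]_d) (u v : 'cV[R]_d) :
  dotv u (M *m v) = dotv (M^T *m u) v.
Proof. by rewrite /dotv trmx_mul trmxK mulmxA. Qed.

(** * Monotonicity of the Laplace transform *)

Lemma laplaceE (R : realType) (dT : measure_display) (T : measurableType dT)
    (P : probability T R) (Z : T -> R) (s : R) :
  laplace P Z s = (\int[P]_w (expR (- s * Z w))%:E)%E.
Proof. by rewrite /laplace unlock. Qed.

Lemma laplace0 (R : realType) (dT : measure_display) (T : measurableType dT)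
    (P : probability T R) (Z : T -> R) : laplace P Z 0 = 1%E.
Proof.
rewrite laplaceE; under eq_integral do rewrite oppr0 mul0r expR0.
by rewrite integral_cst//= probability_setT mule1.
Qed.

Lemma laplace_ge0 (R : realType) (dT : measure_display)
    (T : measurableType dT) (P : probability T R) (Z : T -> R) (s : R) :
  (0 <= laplace P Z s)%E.
Proof.
by rewrite laplaceE; apply: integral_ge0 => w _; rewrite lee_fin expR_ge0.
Qed.

(** Stated as a sum, the gap between the two values makes sense even when they are infinite. The
    absolute value makes its integrand nonnegative everywhere, not just where [0 <= Z w]. *)
Lemma laplace_split (R : realType) (dT : measure_display)
    (T : measurableType dT) (P : probability T R) (Z : {RV P >-> R}) (s t : R) :
  {ae P, forall w, 0 <= Z w} -> s <= t ->
  (laplace P Z s = laplace P Z t +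
     \int[P]_w `|(expR (- s * Z w) - expR (- t * Z w))%:E|)%E.
Proof.
move=> Z0 st; rewrite !laplaceE.
have mexp r : measurable_fun [set: T] (fun w => expR (- r * Z w)).
  by apply: measurableT_comp => //; exact: measurable_funM.
have mdiff : measurable_fun [set: T]
    (fun w => `|(expR (- s * Z w) - expR (- t * Z w))%:E|%E).
  apply: measurableT_comp => //; apply/measurable_EFinP.
  exact: measurable_funB.
rewrite -ge0_integralD//; last exact/measurable_EFinP.
apply: ge0_ae_eq_integral => //.
- exact/measurable_EFinP.
- by apply: emeasurable_funD => //; exact/measurable_EFinP.
- by move=> w _; rewrite adde_ge0.
apply: filterS Z0 => w Zw _.
rewrite abse_EFin -EFinD ger0_norm ?subrKC//.
by rewrite subr_ge0 ler_expR ler_wpM2r// lerN2.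
Qed.

Lemma laplace_anti (R : realType) (dT : measure_display)
    (T : measurableType dT) (P : probability T R) (Z : {RV P >-> R}) (s t : R) :
  {ae P, forall w, 0 <= Z w} -> s <= t -> (laplace P Z t <= laplace P Z s)%E.
Proof.
move=> Z0 st; rewrite (laplace_split _ _ _ _ _ _ _ Z0 st) leeDl//.
by apply: integral_ge0.
Qed.

(** If the gap integral vanished, the two exponentials would agree almost everywhere, forcing
    [Z = 0] almost surely. Finiteness at [t] lets a positive gap give a strict inequality. *)
Lemma laplace_strict_anti (R : realType) (dT : measure_display)
    (T : measurableType dT) (P : probability T R) (Z : {RV P >-> R}) (s t : R) :
  {ae P, forall w, 0 <= Z w} -> (0 < P [set w | Z w != 0%R])%E ->
  s < t -> (laplace P Z t < +oo)%E -> (laplace P Z t < laplace P Z s)%E.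
Proof.
move=> Z0 PZ st Lt; rewrite (laplace_split _ _ _ _ _ _ _ Z0 (ltW st)).
rewrite lteDl ?ge0_fin_numE ?laplace_ge0//.
rewrite lt0e integral_ge0// andbT; apply: contraPneq PZ => /ae_eq_integral_abs.
move=> /(_ measurableT).
have mexp r : measurable_fun [set: T] (fun w => expR (- r * Z w)).
  by apply: measurableT_comp => //; exact: measurable_funM.
case=> [|A [mA PA ZA]].
  by apply/measurable_EFinP; exact: measurable_funB.
(* [A] is a null set off which the exponentials agree; containing the event [Z != 0], it would make
   that event null. *)
suff ZsubA : [set w | Z w != 0%R] `<=` A.
  rewrite ltNge; apply/negP; rewrite negbK -PA le_measure// inE//.
  rewrite (_ : [set w | _] = Z @^-1` [set~ 0]).
    rewrite -[_ @^-1` _]setTI; apply: measurable_funP => //.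
    exact: measurableC.
  by apply/seteqP; split=> w /= /eqP.
move=> w /= /eqP Zw; apply: ZA => /= /(_ I) [] /eqP.
rewrite subr_eq0 => /eqP /expR_inj /eqP; rewrite !mulNr eqr_opp => /eqP.
move=> stZ; apply: Zw.
suff /eqP : (t - s) * Z w = 0 by rewrite mulf_eq0 subr_eq0 gt_eqF//= => /eqP.
by rewrite mulrBl stZ subrr.
Qed.

Lemma laplace_lty (R : realType) (dT : measure_display)
    (T : measurableType dT) (P : probability T R) (Z : {RV P >-> R}) (s : R) :
  {ae P, forall w, 0 <= Z w} -> 0 <= s -> (laplace P Z s < +oo)%E.
Proof.
move=> Z0 /(laplace_anti _ _ _ _ _ _ _ Z0) /le_lt_trans; apply.
by rewrite laplace0 ltry.
Qed.

(** * Expected utility under the mixture model *)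

Lemma measurable_sqrtr (R : realType) (dT : measure_display)
    (T : measurableType dT) (Z : T -> R) :
  measurable_fun [set: T] Z ->
  measurable_fun [set: T] (fun w => Num.sqrt (Z w)).
Proof.
apply: (measurableT_comp (f := @Num.sqrt R)).
by apply: continuous_measurable_fun; exact: sqrt_continuous.
Qed.

(** For fixed [Z = z] the Gaussian moment contributes [z * dotv b b / 2] to the exponent, which
    merges with [- c * z]. *)
Lemma integral_mixture_expR (R : realType) (dT : measure_display)
    (T : measurableType dT) (P : probability T R) (d : nat)
    (Z : {RV P >-> R}) (N : {RV P >-> d.-tuple R}) (c : R) (b : 'cV[R]_d) :
  {ae P, forall w, 0 <= Z w} -> standard_gaussian P N -> independent P Z N ->
  (\int[P]_w
     (expR (- c * Z w + Num.sqrt (Z w) * dotv b (cv_of_tuple (N w))))%:E =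
   laplace P Z (c - dotv b b / 2))%E.
Proof.
move=> Z0 hN ZN.
pose f (p : R * d.-tuple R) : \bar R :=
  (expR (- c * p.1 + Num.sqrt p.1 * dotv b (cv_of_tuple p.2)))%:E.
have mf : measurable_fun [set: R * d.-tuple R] f.
  apply/measurable_EFinP; apply: measurableT_comp => //.
  apply: measurable_funD; first exact: measurable_funM.
  apply: measurable_funM.
    exact: measurable_sqrtr.
  exact: measurable_dotv_tuple.
rewrite (integral_independent _ _ _ _ _ _ _ P Z N f ZN mf); last first.
  by move=> p; rewrite lee_fin expR_ge0.
(* The square of [Num.sqrt z] stays unsimplified: the root of a negative number is 0, so it equals
   [z] only for [0 <= z], which [Z] satisfies almost surely. *)
have innerE z : (\int[P]_v f (z, N v) =
    (expR (- c * z + (Num.sqrt z) ^+ 2 * (dotv b b / 2)))%:E)%E.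
  under eq_integral => v _.
    rewrite /f/= expRD EFinM -dotvZl.
    over.
  rewrite ge0_integralZl//; last first.
    apply/measurable_EFinP; apply: measurableT_comp => //.
    exact: measurable_dotv_tuple.
  rewrite integral_standard_gaussian_expR// -EFinM -expRD dotvZl dotvZr.
  by congr (expR _)%:E; ring.
under eq_integral do rewrite innerE.
rewrite laplaceE; apply: ge0_ae_eq_integral => //.
- apply/measurable_EFinP; apply: measurableT_comp => //.
  apply: measurable_funD; first exact: measurable_funM.
  apply: measurable_funM => //; apply: measurable_funX.
  exact: measurable_sqrtr.
- apply/measurable_EFinP; apply: measurableT_comp => //.
  exact: measurable_funM.
apply: filterS Z0 => w Zw _; rewrite sqr_sqrtr//.
by congr (expR _)%:E; ring.
Qed.

Lemma measurable_normal_mixture (R : realType) (dT : measure_display)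
    (T : measurableType dT) (d : nat) (mu gamma : 'cV[R]_d) (A : 'M[R]_d)
    (Z : T -> R) (N : T -> d.-tuple R) :
  measurable_fun [set: T] Z -> measurable_fun [set: T] N ->
  measurable_fun [set: T]
    (fun w => tuple_of_cv (normal_mixture mu gamma A (Z w) (cv_of_tuple (N w)))).
Proof.
move=> mZ mN; apply/measurable_fun_tnthP => i /=.
have -> : (tnth (T:=R))^~ i \o (fun w =>
      tuple_of_cv (normal_mixture mu gamma A (Z w) (cv_of_tuple (N w)))) =
    (fun w => mu i 0 + Z w * gamma i 0 +
       Num.sqrt (Z w) * dotv (\col_j A i j) (cv_of_tuple (N w))).
  apply/funext => w; rewrite /= tnth_mktuple !mxE dotvE.
  by congr (_ + _ * _); apply: eq_bigr => j _; rewrite !mxE.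
apply: measurable_funD.
  by apply: measurable_funD => //; exact: measurable_funM.
apply: measurable_funM; last exact: measurable_dotv_tuple.
exact: measurable_sqrtr.
Qed.

(** Both sides are integrals against the same law. This moves the expectation from the space of [X]
    to that of [Z] and [N]. *)
Lemma integral_eq_distribution (R : realType) (d1 d2 d3 : measure_display)
    (T1 : measurableType d1) (T2 : measurableType d2) (E : measurableType d3)
    (P1 : probability T1 R) (P2 : probability T2 R)
    (Y1 : T1 -> E) (Y2 : T2 -> E) (f : E -> \bar R) :
  measurable_fun [set: T1] Y1 -> measurable_fun [set: T2] Y2 ->
  eq_distribution P1 P2 Y1 Y2 ->
  measurable_fun [set: E] f -> (forall y, 0 <= f y)%E ->
  (\int[P1]_w f (Y1 w) = \int[P2]_w f (Y2 w))%E.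
Proof.
move=> mY1 mY2 Y12 mf f0.
pose V1 : {RV P1 >-> E} := HB.pack Y1 (isMeasurableFun.Build _ _ _ _ _ mY1).
pose V2 : {RV P2 >-> E} := HB.pack Y2 (isMeasurableFun.Build _ _ _ _ _ mY2).
transitivity (\int[distribution P1 V1]_y f y)%E.
  by rewrite ge0_integral_distribution.
transitivity (\int[distribution P2 V2]_y f y)%E.
  by apply: eq_measure_integral => B mB _; exact: Y12.
by rewrite ge0_integral_distribution.
Qed.

(** Scaling by [a * W0] removes both constants from the part depending on the portfolio. The
    identity includes the value [-oo], reached when the Laplace transform is infinite. *)
Lemma expected_utilityE (R : realType) (d : nat)
  (rf : R) (mu gamma : 'cV[R]_d) (A : 'M[R]_d)
  (dX : measure_display) (TX : measurableType dX) (PX : probability TX R)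
  (X : {RV PX >-> d.-tuple R})
  (dZ : measure_display) (T : measurableType dZ) (P : probability T R)
  (Z : {RV P >-> R}) (N : {RV P >-> d.-tuple R}) (W0 a : R) (x : 'cV[R]_d) :
  {ae P, forall w, 0 <= Z w} -> standard_gaussian P N -> independent P Z N ->
  eq_distribution PX P X
    (fun w => tuple_of_cv (normal_mixture mu gamma A (Z w) (cv_of_tuple (N w)))) ->
  let v := (a * W0) *: x in
  (expected_utility PX X W0 rf a x =
   - ((expR (- a * (W0 * (1 + rf))))%:E *
      ((expR (- dotv v (mu - const_mx rf)))%:E *
       laplace P Z (dotv v gamma - dotv v (A *m A^T *m v) / 2))))%E.
Proof.
move=> Z0 hN ZN XV v.
pose g (t : d.-tuple R) : \bar R :=
  (expR (- a * wealth W0 rf x (cv_of_tuple t)))%:E.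
have wealthE y : - a * wealth W0 rf x y =
    - a * (W0 * (1 + rf)) + - dotv v (y - const_mx rf).
  by rewrite /wealth /v dotvZl; ring.
have mg : measurable_fun [set: d.-tuple R] g.
  apply/measurable_EFinP; apply: measurableT_comp => //.
  under eq_fun do rewrite wealthE dotvBr.
  apply: measurable_funD => //; apply: measurable_funN.
  by apply: measurable_funB => //; exact: measurable_dotv_tuple.
rewrite /expected_utility unlock; under eq_integral do rewrite EFinN.
rewrite integral_ge0N; last by move=> w _; rewrite lee_fin expR_ge0.
congr (- _)%E.
rewrite (integral_eq_distribution _ _ _ _ _ _ _ PX P X _ g _ _ XV mg)//;
  last 2 first.
- exact: measurable_normal_mixture.
- by move=> t; rewrite lee_fin expR_ge0.
(* The Gaussian part of [- dotv v X] is [Num.sqrt z] times the inner product of this [b] with the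
   Gaussian vector. *)
pose b := - (A^T *m v).
under eq_integral => w _.
  rewrite /g (_ : cv_of_tuple (tuple_of_cv _) =
      normal_mixture mu gamma A (Z w) (cv_of_tuple (N w))); last first.
    by apply/colP => i; rewrite mxE tnth_mktuple.
  rewrite wealthE (_ : - dotv v _ = - dotv v (mu - const_mx rf) +
      (- dotv v gamma * Z w + Num.sqrt (Z w) * dotv b (cv_of_tuple (N w))));
      last first.
    rewrite /normal_mixture !dotvBr !dotvDr !dotvZr dotv_mulmx (dotvC _ _ b).
    by rewrite /b dotvNr (dotvC _ _ (A^T *m v)); ring.
  rewrite expRD [expR (_ + (_ + _))]expRD !EFinM.
  over.
have mmix : measurable_fun [set: T] (fun w => (expR (- dotv v gamma * Z w +
    Num.sqrt (Z w) * dotv b (cv_of_tuple (N w))))%:E).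
  apply/measurable_EFinP; apply: measurableT_comp => //.
  apply: measurable_funD; first exact: measurable_funM.
  apply: measurable_funM; last exact: measurable_dotv_tuple.
  exact: measurable_sqrtr.
rewrite ge0_integralZl//; last exact: emeasurable_funM.
rewrite ge0_integralZl// integral_mixture_expR//.
congr (_ * (_ * laplace _ _ (_ - _ / 2)))%E.
by rewrite /b -scaleN1r dotvZl dotvZr -dotv_mulmx mulmxA; ring.
Qed.

(** * Positive definite matrices *)

Lemma dotv_gt0 (R : realType) (d : nat) (v : 'cV[R]_d) :
  v != 0 -> 0 < dotv v v.
Proof.
move=> v0; rewrite dotvE lt_def sumr_ge0 ?andbT; last first.
  by move=> i _; rewrite -expr2 sqr_ge0.
apply: contraNneq v0 => /eqP.
rewrite psumr_eq0 => [/allP vi0|i _]; last by rewrite -expr2 sqr_ge0.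
apply/eqP/colP => i; rewrite mxE; apply/eqP; rewrite -sqrf_eq0 expr2.
by apply: (implyP (vi0 i _)) => //; rewrite mem_index_enum.
Qed.

(** A nonzero vector in the kernel would make the quadratic form vanish. *)
Lemma sym_posdef_unitmx (R : realType) (d : nat) (A : 'M[R]_d) :
  sym_posdef A -> A \in unitmx.
Proof.
move=> [Asym Apos]; rewrite -row_free_unit -kermx_eq0; apply/rowV0P => u.
move=> /sub_kermxP uA; apply/eqP; rewrite -[u]trmxK trmx_eq0.
apply/negPn/negP => /Apos.
by rewrite -[A in A *m _]Asym -trmx_mul uA trmx0 dotvE big1 ?ltxx// => i _;
  rewrite !mxE mulr0.
Qed.

(** The quadratic form at [v] is the squared norm of [A^T *m v], nonzero for [v != 0] since [A] is
    invertible. *)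
Lemma sym_posdef_mulmx_tr (R : realType) (d : nat) (A : 'M[R]_d) :
  sym_posdef A -> sym_posdef (A *m A^T).
Proof.
move=> hA; have [Asym _] := hA; split; first by rewrite trmx_mul trmxK.
move=> v v0; rewrite -mulmxA dotv_mulmx dotv_gt0// Asym.
have Au := sym_posdef_unitmx _ _ _ hA.
by apply: contraNneq v0 => Av0; rewrite -[v](mulKmx Au) Av0 mulmx0.
Qed.

(** * Completing the square in the quadratic form of [S] *)

Section mean_variance.
Variables (R : realType) (d : nat) (S : 'M[R]_d) (m gamma : 'cV[R]_d).
Hypothesis hS : sym_posdef S.
Hypothesis m0 : m != 0.

Let Su : S \in unitmx. Proof. exact: sym_posdef_unitmx. Qed.
Let p := invmx S *m m.
Let C := dotv m p.

Let Sp : S *m p = m. Proof. by rewrite mulmxA mulmxV ?mul1mx. Qed.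

Let dotvS u v : dotv u (S *m v) = dotv v (S *m u).
Proof. by rewrite dotv_mulmx hS.1 dotvC. Qed.

(** [C] is the value at [p] of the quadratic form of [S], and [p] is nonzero because [m] is. *)
Lemma calC_gt0 : 0 < C.
Proof.
rewrite /C dotvC -[X in dotv _ X]Sp hS.2//.
by apply: contraNneq m0 => p0; rewrite -Sp p0 mulmx0.
Qed.

(* The [S]-orthogonal decomposition of [w] along [p]. *)
Lemma dotv_mulmx_decomp (w : 'cV[R]_d) (q := dotv w m / C) (u := w - q *: p) :
  dotv w (S *m w) = q ^+ 2 * C + dotv u (S *m u).
Proof.
have qC : q * C = dotv w m by rewrite divfK// gt_eqF// calC_gt0.
rewrite /u mulmxBr dotvBl !dotvBr -scalemxAr Sp !dotvZr !dotvZl.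
by rewrite (dotvS p) Sp -qC (dotvC _ _ p); rewrite -/C; ring.
Qed.

(** [invmx S *m gamma] is the critical point of the left side in [v], so centring there cancels the
    terms linear in [w]. *)
Lemma exponent_shift (w : 'cV[R]_d) (v := invmx S *m gamma - w) :
  dotv v gamma - dotv v (S *m v) / 2 =
  2^-1 * dotv gamma (invmx S *m gamma) - dotv w (S *m w) / 2.
Proof.
have Sg : S *m (invmx S *m gamma) = gamma by rewrite mulmxA mulmxV ?mul1mx.
rewrite /v mulmxBr !dotvBl !dotvBr (dotvS _ w) Sg (dotvC _ _ gamma).
by field.
Qed.

End mean_variance.

(** * Reduction to a one-dimensional minimization *)

(** Outside [Theta] the argument of [L] falls strictly below [shat], where [L] is infinite.
    Minimizing over [Theta] thus amounts to minimizing over the whole line. *)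
Lemma Theta_of_lty (R : realType) (L : R -> \bar R) (cA cC : R)
    (shat : \bar R) (q : R) :
  0 < cC -> critical_value L shat -> (Qfun L cA cC q < +oo)%E ->
  Theta (theta_hat cA cC shat) q.
Proof.
move=> C0; rewrite /theta_hat; case: shat => [r| |]//=.
  move=> [_ Loo] Qq; rewrite in_itv/= -ler_norml leNgt; apply/negP => rq.
  move: Qq; rewrite /Qfun Loo ?gt0_muley ?ltxx ?lte_fin ?expR_gt0//.
  (* Multiplied out, this says that the argument of [L] is below [r]. *)
  suff : (cA - 2 * r) / cC < q ^+ 2 by rewrite ltr_pdivrMr//; lra.
  rewrite ltNge; apply/negP => /ler_wsqrtr; rewrite sqrtr_sqr.
  by rewrite leNgt rq.
(* For [shat = -oo] the radicand is [+oo], and [Theta] is the whole line. *)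
by move=> _ _; rewrite gt0_muleNy ?lte_fin//= gt0_mulye // lte_fin invr_gt0.
Qed.

(** The probability space is gone: [L] enters through its finiteness on nonnegative reals, its
    monotonicity, strict where finite, and its critical value. *)
Lemma argmin_reduction (R : realType) (d : nat) (S : 'M[R]_d)
    (m gamma : 'cV[R]_d) (L : R -> \bar R) (shat : \bar R) (v : 'cV[R]_d) :
  sym_posdef S -> m != 0 ->
  (forall s : R, (0 <= s)%R -> L s < +oo)%E ->
  (forall s t, (s <= t)%R -> L t <= L s)%E ->
  (forall s t, (s < t)%R -> L t < +oo -> L t < L s)%E ->
  critical_value L shat ->
  let cA := dotv gamma (invmx S *m gamma) in
  let cC := dotv m (invmx S *m m) in
  let J := fun y => ((expR (- dotv y m))%:E *
                     L (dotv y gamma - dotv y (S *m y) / 2)%R)%E in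
  (forall y, (J v <= J y)%E) <->
  exists q : R, argmin_set (Theta (theta_hat cA cC shat)) (Qfun L cA cC) q /\
    v = invmx S *m gamma - q *: (invmx S *m m).
Proof.
move=> hS m0 Lfin Lle Llt hshat cA cC J.
have C0 : 0 < cC by exact: calC_gt0.
pose p := invmx S *m m.
pose g := invmx S *m gamma.
pose k := expR (- dotv g m).
(* [G] is the objective in the centred variable [w = g - v], up to the positive factor [k]. *)
pose G w := ((expR (dotv w m))%:E * L (2^-1 * cA - dotv w (S *m w) / 2)%R)%E.
have JG w : J (g - w) = (k%:E * G w)%E.
  rewrite /J exponent_shift// dotvBl /k /G muleA -EFinM -expRD.
  by congr ((expR _)%:E * _)%E; ring.
have JGle w1 w2 : (J (g - w1)%R <= J (g - w2)%R)%E = (G w1 <= G w2)%E.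
  by rewrite !JG lee_pmul2l// lte_fin expR_gt0.
have gK w : w = g - (g - w) by rewrite subKr.
have pm : dotv p m = cC by rewrite dotvC.
have Gp q : G (q *: p) = Qfun L cA cC q.
  rewrite /G /Qfun -scalemxAr dotvZl dotvZr dotvZl /p mulmxA mulmxV.
    rewrite mul1mx pm [q * cC]mulrC; congr (_ * L _)%E.
    by rewrite expr2; field.
  exact: sym_posdef_unitmx.
(* Coefficient of [w] along [p] in the [S]-orthogonal decomposition. *)
pose qw (w : 'cV[R]_d) := dotv w m / cC.
have Gqw w : G w = ((expR (cC * qw w))%:E *
    L ((2^-1 * cA - (qw w) ^+ 2 / 2 * cC) -
       dotv (w - qw w *: p) (S *m (w - qw w *: p)) / 2)%R)%E.
  rewrite /G (dotv_mulmx_decomp R d S m)//=.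
  congr ((expR _)%:E * L _)%E; first by rewrite /qw mulrC divfK// gt_eqF.
  by rewrite -/p -/cC -/(qw w); field.
have Sge0 u : 0 <= dotv u (S *m u).
  have [->|u0] := eqVneq u 0; last by rewrite ltW// hS.2.
  by rewrite mulmx0 dotvE big1// => i _; rewrite mxE mul0r.
have QG w : (Qfun L cA cC (qw w) <= G w)%E.
  rewrite Gqw lee_wpmul2l ?lee_fin ?expR_ge0//; apply: Lle.
  by rewrite gerBl divr_ge0.
have QG_lt w : w != qw w *: p -> (G w < +oo)%E -> (Qfun L cA cC (qw w) < G w)%E.
  move=> wp /(le_lt_trans (QG w)) Qoo.
  rewrite Gqw lte_pmul2l ?lte_fin ?expR_gt0//; apply: Llt.
    by rewrite gtrBl divr_gt0// hS.2// subr_eq0.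
  (* Strictness needs [L] finite at the larger argument, the one in [Qfun]; otherwise [Qfun] would
     be infinite, although it is at most the finite [G w]. *)
  rewrite ltey; apply: contraTneq Qoo => Loo.
  by rewrite /Qfun Loo gt0_muley ?lte_fin ?expR_gt0// ltxx.
split=> [vmin|[q [[Tq Qq]] ->] y]; last first.
  rewrite (gK y) JGle Gp; apply: le_trans (QG _).
  (* [qw (g - y)] may lie outside [Theta]; then [Qfun] is infinite there and the bound is
     trivial. *)
  have [/(Theta_of_lty _ _ _ _ _ _ C0 hshat)/Qq//|] :=
    ltP (Qfun L cA cC (qw (g - y))) +oo%E.
  by rewrite leye_eq => /eqP ->; rewrite leey.
pose w := g - v.
have Gmin y : (G w <= G y)%E by rewrite -JGle -gK.
(* Comparison with [w = 0], where the argument of [L] is [2^-1 * cA], which is nonnegative. *)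
have Goo : (G w < +oo)%E.
  apply: le_lt_trans (Gmin 0) _.
  rewrite /G mulmx0 (_ : dotv 0 m = 0); last first.
    by rewrite dotvE big1// => i _; rewrite mxE mul0r.
  rewrite expR0 mul1e Lfin// (_ : dotv 0 0 = 0); last first.
    by rewrite dotvE big1// => i _; rewrite mxE mul0r.
  rewrite mul0r subr0 mulr_ge0//.
  have Sg : S *m g = gamma by rewrite mulmxA mulmxV ?mul1mx ?sym_posdef_unitmx.
  by rewrite /cA dotvC -[X in dotv _ X]Sg.
(* Otherwise the multiple [qw w *: p] would do strictly better than the minimizer [w]. *)
have wE : w = qw w *: p.
  apply/eqP/negPn/negP => /QG_lt /(_ Goo).
  by rewrite ltNge -Gp Gmin.
exists (qw w); split; last by rewrite -/p -wE -gK.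
have QGw : Qfun L cA cC (qw w) = G w by rewrite -Gp -wE.
split; first by apply: Theta_of_lty hshat _ => //; rewrite QGw.
by move=> y _; rewrite QGw -Gp.
Qed.

Theorem theorem2p16 (R : realType) (d : nat) (hd : (0 < d)%N)
  (rf : R) (mu gamma : 'cV[R]_d) (A : 'M[R]_d) (hA : sym_posdef A)
  (dX : measure_display) (TX : measurableType dX) (PX : probability TX R)
  (X : {RV PX >-> d.-tuple R})
  (dZ : measure_display) (T : measurableType dZ) (P : probability T R)
  (Z : {RV P >-> R}) (N : {RV P >-> d.-tuple R})
  (hZ0 : {ae P, forall w, 0 <= Z w})
  (hN : standard_gaussian P N)
  (hZN : independent P Z N)
  (hX : eq_distribution PX P X
     (fun w => tuple_of_cv (normal_mixture mu gamma A (Z w) (cv_of_tuple (N w)))))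
  (hmu : mu - const_mx rf != 0)
  (hZ : (0 < P [set w | Z w != 0%R])%E)
  (W0 a : R) (hW0 : 0 < W0) (ha : 0 < a)
  (shat : \bar R) (hshat : critical_value (laplace P Z) shat)
  (xstar : 'cV[R]_d) :
  let Sigma := A *m A^T in
  let cA := calA Sigma gamma in
  let cC := calC Sigma mu rf in
  argmax_set [set: 'cV[R]_d] (expected_utility PX X W0 rf a) xstar <->
  exists qmin : R,
    argmin_set (Theta (theta_hat cA cC shat)) (Qfun (laplace P Z) cA cC) qmin /\
    xstar = (a * W0)^-1 *:
      (invmx Sigma *m gamma - qmin *: (invmx Sigma *m (mu - const_mx rf))).
Proof.
move=> Sigma cA cC.
have aW0 : a * W0 != 0 by rewrite mulf_neq0 ?gt_eqF.
have red := argmin_reduction R d Sigma (mu - const_mx rf) gamma (laplace P Z)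
  shat ((a * W0) *: xstar) (sym_posdef_mulmx_tr _ _ _ hA) hmu
  (fun s => laplace_lty _ _ _ P Z s hZ0)
  (fun s t => laplace_anti _ _ _ P Z s t hZ0)
  (fun s t => laplace_strict_anti _ _ _ P Z s t hZ0 hZ) hshat.
(* Expected utility is a negative constant times the reduced objective, hence the exchange of [x]
   and [y]. *)
have EUle x y : (expected_utility PX X W0 rf a x <=
    expected_utility PX X W0 rf a y)%E =
  (((expR (- dotv ((a * W0) *: y) (mu - const_mx rf)))%:E *
     laplace P Z (dotv ((a * W0) *: y) gamma -
       dotv ((a * W0) *: y) (Sigma *m ((a * W0) *: y)) / 2)%R) <=
   ((expR (- dotv ((a * W0) *: x) (mu - const_mx rf)))%:E *
     laplace P Z (dotv ((a * W0) *: x) gamma -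
       dotv ((a * W0) *: x) (Sigma *m ((a * W0) *: x)) / 2)%R))%E.
  rewrite !(expected_utilityE R d rf mu gamma A dX TX PX X dZ T P Z N)//.
  by rewrite leeN2 lee_pmul2l// lte_fin expR_gt0.
split=> [[_ xmax]|[q [qmin xE]]].
  have [|q [qmin vE]] := red.1.
    (* Scaling by [a * W0] is a bijection, so every [y] comes from a portfolio. *)
    move=> y; have := xmax ((a * W0)^-1 *: y) I.
    by rewrite EUle scalerA divff// scale1r.
  by exists q; split=> //; rewrite -vE scalerA mulVf// scale1r.
split=> // y _; rewrite EUle; apply: red.2.
by exists q; split=> //; rewrite xE scalerA divff// scale1r.
Qed.
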